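(* Let $S\in\mathcal S_d(\mathcal U,\mathcal Y)$ and let $$S(\lambda)=D+C(I_{\mathcal X}-Z(\lambda)A)^{-1}Z(\lambda)B\qquad(\lambda\in\mathbb B^d)$$ be a contractive realization of $S$ with state space $\mathcal X$ and connecting operator $\mathbf U=\begin{bmatrix}A&B\\ C&D\end{bmatrix}:\mathcal X\oplus\mathcal U\to\mathcal X^d\oplus\mathcal Y$. This realization is weakly coisometric if and only if $$K_S(\lambda,\zeta)=K_{C,\mathbf A}(\lambda,\zeta)\qquad\text{for all }\lambda,\zeta\in\mathbb B^d .$$
   Context: $\mathcal U,\mathcal Y,\mathcal X$ are Hilbert spaces and $\mathcal L(\cdot,\cdot)$ denotes bounded linear operators. $\mathbb B^d$ is the open unit ball of $\mathbb C^d$ with inner product $\langle\lambda,\zeta\rangle=\sum_j\lambda_j\overline{\zeta_j}$; $\mathcal H(k_d)$ is the reproducing kernel Hilbert space on $\mathbb B^d$ with kernel $k_d(\lambda,\zeta)=1/(1-\langle\lambda,\zeta\rangle)$ and $\mathcal H_{\mathcal Y}(k_d)=\mathcal H(k_d)\otimes\mathcal Y$, viewed as a space of $\mathcal Y$-valued functions. $\mathcal S_d(\mathcal U,\mathcal Y)$ is the set of $\mathcal L(\mathcal U,\mathcal Y)$-valued analytic functions $S$ on $\mathbb B^d$ such that $f\mapsto S f$ is a contraction from $\mathcal H_{\mathcal U}(k_d)$ into $\mathcal H_{\mathcal Y}(k_d)$. Put $K_S(\lambda,\zeta)=\dfrac{I_{\mathcal Y}-S(\lambda)S(\zeta)^*}{1-\langle\lambda,\zeta\rangle}$.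 For $\mathbf A=(A_1,\dots,A_d)\in\mathcal L(\mathcal X)^d$ and $B_1,\dots,B_d\in\mathcal L(\mathcal U,\mathcal X)$, $A:\mathcal X\to\mathcal X^d$ and $B:\mathcal U\to\mathcal X^d$ are the columns with entries $A_j$ and $B_j$, and $Z(\lambda)=[\lambda_1I_{\mathcal X}\ \cdots\ \lambda_dI_{\mathcal X}]:\mathcal X^d\to\mathcal X$. For $C\in\mathcal L(\mathcal X,\mathcal Y)$, $$K_{C,\mathbf A}(\lambda,\zeta)=C(I-\lambda_1A_1-\cdots-\lambda_dA_d)^{-1}(I-\overline{\zeta_1}A_1^*-\cdots-\overline{\zeta_d}A_d^* )^{-1}C^* .$$ A realization $S(\lambda)=D+C(I-Z(\lambda)A)^{-1}Z(\lambda)B$ is contractive if $\mathbf U$ is a contraction. It is weakly coisometric if $\mathbf U^*:\mathcal X^d\oplus\mathcal Y\to\mathcal X\oplus\mathcal U$ is contractive and is isometric on the subspace $\mathcal D\oplus\mathcal Y$, where $$\mathcal D=\overline{\operatorname{span}}\{Z(\zeta)^*(I-A^*Z(\zeta)^* )^{-1}C^*y:\ \zeta\in\mathbb B^d,\ y\in\mathcal Y\}\subset\mathcal X^d .$$ *)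

(* Defs.v *)
From HB Require Import structures.
From mathcomp Require Import all_boot all_order all_algebra.
From mathcomp Require Import sesquilinear.
From mathcomp Require Import complex.
From mathcomp Require Import boolp classical_sets functions reals.
From mathcomp Require Import topology normedtype derive.
From mathcomp Require Import ring.

Set Implicit Arguments.
Unset Strict Implicit.
Unset Printing Implicit Defensive.

Import Order.TTheory GRing.Theory Num.Theory.
Import numFieldNormedType.Exports.

Local Open Scope classical_set_scope.
Local Open Scope ring_scope.

(* The norm is the library's R[i]-valued one; the order on R[i] is the partial
   order in which 0 <= z means that z is real and nonnegative. *)
HB.mixin Record CompleteNormedModule_isHilbert (R : realType) H
    of CompleteNormedModule R[i] H := {
  inner : {dot H for @Num.conj R[i]} ;
  norm_inner : forall x : H, `|x| ^+ 2 = inner x x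
}.

#[short(type="hilbertType")]
HB.structure Definition Hilbert (R : realType) :=
  {H of CompleteNormedModule R[i] H & CompleteNormedModule_isHilbert R H}.

Section DotNorm.
Variables (C : numClosedFieldType) (U : lmodType C).
Variable form : {dot U for @Num.conj C}.

Lemma dot_CauchySchwarz u v : `|form u v| ^+ 2 <= form u u * form v v.
Proof.
have [-> | nz_v] := eqVneq v 0.
  by rewrite !linear0r normr0 expr0n.
have vv_gt0 : 0 < form v v by rewrite dnorm_gt0.
rewrite -subr_ge0 -(pmulr_lge0 _ vv_gt0).
have := dnorm_ge0 form (form v v *: u - form u v *: v).
rewrite dnormB !dnormZ linearZr_LR /= [form (_ *: u) v]linearZl_LR.
rewrite (ger0_norm (ltW vv_gt0)) mulrCA [_^* * _]mulrC -normCK.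
have real_t : form v v * `|form u v| ^+ 2 \is Num.real.
  by rewrite ger0_real // mulr_ge0 ?exprn_ge0 ?normr_ge0 // ltW.
rewrite (CrealP real_t).
by set c := `|_| ^+ 2; congr (0 <= _); rewrite mulrBl; ring.
Qed.

Lemma sqrt_dnormD u v :
  sqrtC (form (u + v) (u + v)) <= sqrtC (form u u) + sqrtC (form v v).
Proof.
rewrite -ler_sqr ?nnegrE ?addr_ge0 ?sqrtC_ge0 ?dnorm_ge0 //.
rewrite sqrrD !sqrtCK dnormD [leRHS]addrAC lerD2l.
have -> : form u v + (form u v)^* = 'Re (form u v) *+ 2.
  by rewrite ReE -mulr_natr divfK // pnatr_eq0.
rewrite lerMn2r /=; apply: le_trans (_ : `|form u v| <= _).
  by rewrite (leif_Re_Creal _).1.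
rewrite -ler_sqr ?nnegrE ?mulr_ge0 ?sqrtC_ge0 ?dnorm_ge0 ?normr_ge0 //.
by rewrite exprMn !sqrtCK dot_CauchySchwarz.
Qed.

Lemma sqrt_dnormZ a u : sqrtC (form (a *: u) (a *: u)) = `|a| * sqrtC (form u u).
Proof.
rewrite dnormZ sqrtCM ?nnegrE ?exprn_ge0 ?dnorm_ge0 ?normr_ge0 //.
by rewrite exprCK ?normr_ge0.
Qed.

Lemma sqrt_dnorm_eq0_eq0 u : sqrtC (form u u) = 0 -> u = 0.
Proof. by move/eqP; rewrite sqrt_dnorm_eq0 => /eqP. Qed.

End DotNorm.

HB.factory Record Lmodule_isHilbert (R : realType) H
    of GRing.Lmodule R[i] H := {
  dot : {dot H for @Num.conj R[i]} ;
  dot_complete : forall F : set_system H, ProperFilter F ->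
    (forall e : R[i], 0 < e ->
       exists x, F [set y | sqrtC (dot (x - y) (x - y)) < e]) ->
    exists l, forall e : R[i], 0 < e ->
       F [set y | sqrtC (dot (l - y) (l - y)) < e]
}.

HB.builders Context R H of Lmodule_isHilbert R H.

HB.instance Definition _ := Lmodule_isNormed.Build R[i] H
  (@sqrt_dnormD _ _ dot) (@sqrt_dnormZ _ _ dot) (@sqrt_dnorm_eq0_eq0 _ _ dot).

Let complete (F : set_system H) : ProperFilter F -> cauchy F -> cvg F.
Proof.
move=> PF /cauchyP Fc; have [l Fl] := dot_complete PF Fc.
by apply/cvg_ex; exists l; apply/cvgrPdist_lt => e e0; exact: Fl.
Qed.

HB.instance Definition _ := Uniform_isComplete.Build H complete.

Let norm_dot (x : H) : `|x| ^+ 2 = dot x x.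
Proof. exact: sqrtCK. Qed.

HB.instance Definition _ := CompleteNormedModule_isHilbert.Build R H norm_dot.
HB.end.

Lemma hilbert_complete (R : realType) (H : hilbertType R) (F : set_system H) :
  ProperFilter F ->
  (forall e : R[i], 0 < e -> exists x, F [set y | `|x - y| < e]) ->
  exists l, forall e : R[i], 0 < e -> F [set y | `|l - y| < e].
Proof.
move=> PF Fc; have /cauchy_exP/cauchy_cvg/cvg_ex[l] : cauchy_ex F.
  by move=> e e0; have [x Fx] := Fc e e0; exists x; rewrite -ball_normE.
by move=> /cvgrPdist_lt Fl; exists l => e e0; exact: Fl.
Qed.
Section ComplexHilbert.
Variable R : realType.
Local Notation C := R[i].

(* R[i] as a Hilbert space over itself. *)
Definition hscalar : Type := C.
HB.instance Definition _ := NormedModule.copy hscalar C^o.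

Definition hscalar_dot (x y : hscalar) : C := x * y^*.

Let hscalar_dot_bilinear :
  bilinear_for (GRing.Scale.Law.clone _ _ *%R _)
               (GRing.Scale.Law.clone _ _ (@Num.conj C \; *%R) _) hscalar_dot.
Proof.
split=> [y|x] a u v; rewrite /hscalar_dot /=.
  by rewrite mulrDl -mulrA.
by rewrite rmorphD rmorphM mulrDr mulrCA.
Qed.
HB.instance Definition _ :=
  bilinear_isBilinear.Build C hscalar hscalar C _ _ hscalar_dot hscalar_dot_bilinear.

Let hscalar_dot_herm (x y : hscalar) :
  hscalar_dot x y = (-1) ^+ false * (hscalar_dot y x)^*.
Proof. by rewrite /hscalar_dot expr0 mul1r rmorphM /= conjCK mulrC. Qed.
HB.instance Definition _ :=
  isHermitianSesquilinear.Build C hscalar false (@Num.conj C) hscalar_dot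
    hscalar_dot_herm.

Let hscalar_dot_gt0 (x : hscalar) : x != 0 -> 0 < hscalar_dot x x.
Proof. by move=> x0; rewrite /hscalar_dot -normCK exprn_gt0 // normr_gt0. Qed.
HB.instance Definition _ := isDotProduct.Build C hscalar hscalar_dot hscalar_dot_gt0.

Let normc_le (z : C) : `|z| <= (`|complex.Re z| + `|complex.Im z|)%:C%C.
Proof.
rewrite [in leLHS](complexE z) (le_trans (ler_normD _ _)) // rmorphD /= lerD //.
  by rewrite normc_def /= expr0n addr0 sqrtr_sqr.
by rewrite normrM [`|'i%C|]normc_def /= expr0n expr1n add0r sqrtr1 mul1r
  normc_def /= expr0n addr0 sqrtr_sqr.
Qed.

Let normc_ge_Im (z : C) : `|complex.Im z|%:C%C <= `|z|.
Proof. by rewrite normc_def lecR -sqrtr_sqr ler_wsqrtr // lerDr sqr_ge0. Qed.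

Let hscalar_complete (F : set_system hscalar) : ProperFilter F -> cauchy F -> cvg F.
Proof.
move=> PF /cauchyP Fc.
have part (p : C -> R) : (forall x y, p (x - y) = p x - p y) ->
    (forall z, `|p z|%:C%C <= `|z|) ->
    exists l, forall e, 0 < e -> F [set z | `|l - p z| < e].
  move=> pB p_le.
  have /cauchy_exP/cauchy_cvg/cvg_ex[l] : cauchy_ex (p @ F).
    move=> e e0; have [|x Fx] := Fc e%:C%C; first by rewrite ltcR.
    have Fpx : F [set z | `|p x - p z| < e].
      apply: filterS Fx => z; rewrite -ball_normE /ball_ /= => xz.
      by rewrite -ltcR -pB; apply: le_lt_trans xz; exact: p_le.
    by exists (p x); rewrite -ball_normE; exact: Fpx.
  by move=> /cvgrPdist_lt Fl; exists l => e e0; exact: Fl.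
have [|a Fa] := part (@complex.Re R) _ (@normc_ge_Re R).
  by move=> [? ?] [? ?].
have [|b Fb] := part (@complex.Im R) _ normc_ge_Im.
  by move=> [? ?] [? ?].
apply/cvg_ex; exists (Complex a b : hscalar); apply/cvgrPdist_lt => -[e e'].
rewrite ltcE /= => /andP[/eqP -> e0].
have e20 : 0 < e / 2 by rewrite divr_gt0.
apply: filterS2 (Fa _ e20) (Fb _ e20) => -[x y] /= ax bxy.
apply: le_lt_trans (normc_le _) _; rewrite /= ltcR.
by rewrite (splitr e) ltrD.
Qed.
HB.instance Definition _ := Uniform_isComplete.Build hscalar hscalar_complete.

Let hscalar_norm_dot (x : hscalar) : `|x| ^+ 2 = hscalar_dot x x.
Proof. exact: normCK. Qed.
HB.instance Definition _ :=
  CompleteNormedModule_isHilbert.Build R hscalar hscalar_norm_dot.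

End ComplexHilbert.

Section DirectSum.
Variables (R : realType) (H K : hilbertType R).
Local Notation C := R[i].

(* A copy of H * K, whose library norm is the maximum norm. *)
Definition hsum : Type := (H * K)%type.
HB.instance Definition _ := GRing.Lmodule.copy hsum (H * K)%type.

Definition hsum_dot (p q : hsum) : C := inner p.1 q.1 + inner p.2 q.2.

Let hsum_dot_bilinear :
  bilinear_for (GRing.Scale.Law.clone _ _ *%R _)
               (GRing.Scale.Law.clone _ _ (@Num.conj C \; *%R) _) hsum_dot.
Proof.
split=> [q|p] a u v; rewrite /hsum_dot /=.
  by rewrite !linearPl /= mulrDr addrACA.
by rewrite !linearPr /= mulrDr addrACA.
Qed.
HB.instance Definition _ :=
  bilinear_isBilinear.Build C hsum hsum C _ _ hsum_dot hsum_dot_bilinear.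

Let hsum_dot_herm (p q : hsum) :
  hsum_dot p q = (-1) ^+ false * (hsum_dot q p)^*.
Proof.
rewrite /hsum_dot rmorphD mulrDr /=.
by congr (_ + _); rewrite hermC.
Qed.
HB.instance Definition _ :=
  isHermitianSesquilinear.Build C hsum false (@Num.conj C) hsum_dot
    hsum_dot_herm.

Let hsum_dot_gt0 (p : hsum) : p != 0 -> 0 < hsum_dot p p.
Proof.
move=> p0; rewrite lt_def addr_ge0 ?dnorm_ge0 // andbT.
apply: contra_neq p0; case: p => x y /eqP.
rewrite /hsum_dot /= paddr_eq0 ?dnorm_ge0 // !dnorm_eq0.
by case/andP=> /eqP -> /eqP ->.
Qed.
HB.instance Definition _ := isDotProduct.Build C hsum hsum_dot hsum_dot_gt0.

Let norm1_le (p : hsum) : `|p.1| <= sqrtC (hsum_dot p p).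
Proof.
rewrite -ler_sqr ?nnegrE ?sqrtC_ge0 ?dnorm_ge0 // sqrtCK norm_inner.
by rewrite lerDl dnorm_ge0.
Qed.

Let norm2_le (p : hsum) : `|p.2| <= sqrtC (hsum_dot p p).
Proof.
rewrite -ler_sqr ?nnegrE ?sqrtC_ge0 ?dnorm_ge0 // sqrtCK norm_inner.
by rewrite lerDr dnorm_ge0.
Qed.

Let norm_le12 (p : hsum) : sqrtC (hsum_dot p p) <= `|p.1| + `|p.2|.
Proof.
rewrite -ler_sqr ?nnegrE ?sqrtC_ge0 ?addr_ge0 ?dnorm_ge0 // sqrtCK sqrrD.
by rewrite !norm_inner addrAC lerDl mulrn_wge0 // mulr_ge0.
Qed.

Let hsum_complete (F : set_system hsum) : ProperFilter F ->
  (forall e : C, 0 < e ->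
     exists x, F [set y | sqrtC (hsum_dot (x - y) (x - y)) < e]) ->
  exists l, forall e : C, 0 < e ->
     F [set y | sqrtC (hsum_dot (l - y) (l - y)) < e].
Proof.
move=> PF Fc.
have [|a Fa] := @hilbert_complete R H (fst @ F) _.
  move=> e e0; have [x Fx] := Fc e e0; exists x.1.
  have : F [set y : hsum | `|x.1 - y.1| < e]; last by [].
  by apply: filterS Fx => y /=; apply: le_lt_trans (norm1_le (x - y)).
have [|b Fb] := @hilbert_complete R K (snd @ F) _.
  move=> e e0; have [x Fx] := Fc e e0; exists x.2.
  have : F [set y : hsum | `|x.2 - y.2| < e]; last by [].
  by apply: filterS Fx => y /=; apply: le_lt_trans (norm2_le (x - y)).
exists (a, b) => e e0; have e20 : 0 < e / 2 by rewrite divr_gt0.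
have Fa2 : F [set y : hsum | `|a - y.1| < e / 2] by exact: Fa.
have Fb2 : F [set y : hsum | `|b - y.2| < e / 2] by exact: Fb.
apply: filterS2 Fa2 Fb2 => y /= ya yb.
by apply: le_lt_trans (norm_le12 _) _; rewrite (splitr e) ltrD.
Qed.
HB.instance Definition _ := Lmodule_isHilbert.Build R hsum hsum_complete.

Lemma hsum_innerE (p q : hsum) : inner p q = inner p.1 q.1 + inner p.2 q.2.
Proof. by []. Qed.

End DirectSum.

Section DirectPower.
Variables (R : realType) (d : nat) (H : hilbertType R).
Local Notation C := R[i].

(* A copy of the function space 'I_d -> H, which carries no norm. *)
Definition hpow : Type := 'I_d -> H.
HB.instance Definition _ := GRing.Lmodule.copy hpow ('I_d -> H).

Definition hpow_dot (p q : hpow) : C := \sum_(j < d) inner (p j) (q j).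

Let hpow_dot_bilinear :
  bilinear_for (GRing.Scale.Law.clone _ _ *%R _)
               (GRing.Scale.Law.clone _ _ (@Num.conj C \; *%R) _) hpow_dot.
Proof.
split=> [q|p] a u v; rewrite /hpow_dot /= mulr_sumr -big_split /=.
  by apply: eq_bigr => j _; rewrite linearPl.
by apply: eq_bigr => j _; rewrite linearPr.
Qed.
HB.instance Definition _ :=
  bilinear_isBilinear.Build C hpow hpow C _ _ hpow_dot hpow_dot_bilinear.

Let hpow_dot_herm (p q : hpow) :
  hpow_dot p q = (-1) ^+ false * (hpow_dot q p)^*.
Proof.
rewrite /hpow_dot rmorph_sum mulr_sumr /=.
by apply: eq_bigr => j _; rewrite hermC.
Qed.
HB.instance Definition _ :=
  isHermitianSesquilinear.Build C hpow false (@Num.conj C) hpow_dot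
    hpow_dot_herm.

Let hpow_dot_ge0 (p : hpow) : 0 <= hpow_dot p p.
Proof. by rewrite sumr_ge0 // => j _; rewrite dnorm_ge0. Qed.

Let hpow_dot_gt0 (p : hpow) : p != 0 -> 0 < hpow_dot p p.
Proof.
move=> p0; rewrite lt_def hpow_dot_ge0 andbT.
apply: contra_neq p0 => /eqP; rewrite psumr_eq0 => [/allP p0|j _]; last first.
  exact: dnorm_ge0.
apply/funext => j; have := p0 j; rewrite mem_index_enum => /(_ isT) /=.
by rewrite dnorm_eq0 => /eqP.
Qed.
HB.instance Definition _ := isDotProduct.Build C hpow hpow_dot hpow_dot_gt0.

Let norm_coord_le (p : hpow) j : `|p j| <= sqrtC (hpow_dot p p).
Proof.
rewrite -ler_sqr ?nnegrE ?sqrtC_ge0 ?hpow_dot_ge0 // sqrtCK norm_inner.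
by rewrite /hpow_dot (bigD1 j) //= lerDl sumr_ge0 // => k _; rewrite dnorm_ge0.
Qed.

Let norm_le_sum (p : hpow) : sqrtC (hpow_dot p p) <= \sum_(j < d) `|p j|.
Proof.
rewrite -ler_sqr ?nnegrE ?sqrtC_ge0 ?hpow_dot_ge0 ?sumr_ge0 // sqrtCK.
rewrite expr2 mulr_suml ler_sum // => j _.
by rewrite -norm_inner expr2 ler_wpM2l // (bigD1 j) //= lerDl sumr_ge0.
Qed.

Let hpow_complete (F : set_system hpow) : ProperFilter F ->
  (forall e : C, 0 < e ->
     exists x, F [set y | sqrtC (hpow_dot (x - y) (x - y)) < e]) ->
  exists l, forall e : C, 0 < e ->
     F [set y | sqrtC (hpow_dot (l - y) (l - y)) < e].
Proof.
move=> PF Fc.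
have lim_coord j : exists l : H, forall e : C, 0 < e ->
    F [set y | `|l - y j| < e].
  have [|l Fl] := @hilbert_complete R H ((fun y : hpow => y j) @ F) _.
    move=> e e0; have [x Fx] := Fc e e0; exists (x j).
    have : F [set y : hpow | `|x j - y j| < e]; last by [].
    by apply: filterS Fx => y /=; apply: le_lt_trans (norm_coord_le (x - y) j).
  by exists l.
have [l Fl] := choice lim_coord.
exists l => e e0; have e20 : 0 < e / d.+1%:R by rewrite divr_gt0 // ltr0n.
have : \forall y \near F, forall j, `|l j - y j| < e / d.+1%:R.
  by apply: filter_forall => j; exact: Fl.
apply: filterS => y yl; apply: le_lt_trans (norm_le_sum _) _.
apply: (@le_lt_trans _ _ (\sum_(j < d) (e / d.+1%:R))).
  by apply: ler_sum => j _; exact/ltW/yl.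
rewrite sumr_const card_ord -[ltLHS]mulr_natl mulrA ltr_pdivrMr ?ltr0n //.
by rewrite mulrC ltr_pM2l // ltr_nat.
Qed.
HB.instance Definition _ := Lmodule_isHilbert.Build R hpow hpow_complete.

Lemma hpow_innerE (p q : hpow) : inner p q = \sum_(j < d) inner (p j) (q j).
Proof. by []. Qed.

End DirectPower.
Section BoundedOperators.
Variables (R : realType) (H K : hilbertType R).
Local Notation C := R[i].

Definition bounded_linear (T : H -> K) : Prop :=
  linear T /\ exists M : C, forall x, `|T x| <= M * `|x|.

Definition bounded_linear_pred : {pred H -> K} :=
  fun T => `[< bounded_linear T >].

Let bounded_linear_submod : submod_closed bounded_linear_pred.
Proof.
split=> [|a S T /asboolP[linS [M leM]] /asboolP[linT [N leN]]]; apply/asboolP.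
  split=> [a x y|].
    by rewrite -[LHS]/(0 : K) -[RHS]/(a *: 0 + 0 : K) scaler0 addr0.
  by exists 0 => x; rewrite mul0r -[X in `|X|]/(0 : K) normr0.
have actE x : (a *: S + T) x = a *: S x + T x by [].
split.
  move=> b x y; rewrite !actE linS linT !scalerDr !scalerA (mulrC a b) addrACA.
  by [].
exists (`|a| * M + N) => x; rewrite actE (le_trans (ler_normD _ _)) //.
by rewrite mulrDl lerD // normrZ -mulrA ler_wpM2l.
Qed.
HB.instance Definition _ :=
  GRing.isSubmodClosed.Build C (H -> K) bounded_linear_pred
    bounded_linear_submod.

Record bop := Bop {
  bop_fun :> H -> K ;
  bop_subproof : bop_fun \in bounded_linear_pred
}.
HB.instance Definition _ := [isSub for bop_fun].
HB.instance Definition _ := [Choice of bop by <:].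
HB.instance Definition _ := [SubChoice_isSubLmodule of bop by <:].

Lemma bop_boundedP (T : bop) : bounded_linear T.
Proof. by apply/asboolP; exact: bop_subproof T. Qed.

Lemma bop_linear (T : bop) : linear T.
Proof. by have [] := bop_boundedP T. Qed.
HB.instance Definition _ (T : bop) :=
  GRing.isLinear.Build C H K _ (T : H -> K) (bop_linear T).

Lemma bop_bounded (T : bop) : exists2 M : C, 0 <= M & forall x, `|T x| <= M * `|x|.
Proof.
have [_ [M leM]] := bop_boundedP T; exists `|M| => // x.
have Mx_ge0 := le_trans (normr_ge0 _) (leM x).
by rewrite -[`|x|]normr_id -normrM ger0_norm.
Qed.

Lemma bopP (S T : bop) : S = T <-> forall x, S x = T x.
Proof. by split=> [-> // | eqST]; apply/val_inj/funext. Qed.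

Lemma bopD (S T : bop) x : (S + T) x = S x + T x. Proof. by []. Qed.
Lemma bopZ a (T : bop) x : (a *: T) x = a *: T x. Proof. by []. Qed.

(* The norm of a vector is an element of R[i], hence the detour by the real
   part to take a supremum in R. *)
Definition opnorm (T : bop) : C :=
  (sup [set complex.Re `|T x| | x in [set x | `|x| <= 1]])%:C%C.

Lemma le_opnorm_unit (T : bop) x : `|x| <= 1 -> `|T x| <= opnorm T.
Proof.
move=> x1; have ReE (z : K) : `|z| = (complex.Re `|z|)%:C%C.
  by rewrite RRe_real ?normr_real.
rewrite /opnorm ReE lecR; apply: ub_le_sup; last by exists x.
have [M M0 leM] := bop_bounded T; exists (complex.Re M) => _ [y y1 <-].
rewrite -lecR -ReE RRe_real ?ger0_real // (le_trans (leM y)) //.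
by rewrite ler_piMr.
Qed.

Lemma opnorm_le (T : bop) (M : C) :
  (forall x, `|x| <= 1 -> `|T x| <= M) -> opnorm T <= M.
Proof.
move=> leM; have M0 : 0 <= M.
  by apply: le_trans (leM 0 _) => //; rewrite normr0.
rewrite -[M]RRe_real ?ger0_real // /opnorm lecR; apply: ge_sup.
  by exists (complex.Re `|T 0|); exists 0 => //=; rewrite normr0.
move=> _ [x x1 <-]; rewrite -lecR !RRe_real ?ger0_real //; exact: leM.
Qed.

Lemma le_opnorm (T : bop) x : `|T x| <= opnorm T * `|x|.
Proof.
have [->|x0] := eqVneq x 0; first by rewrite linear0 !normr0 mulr0.
have nx0 : 0 < `|x| by rewrite normr_gt0.
rewrite -ler_pdivrMr // mulrC -[`|x|^-1]ger0_norm ?invr_ge0 //.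
rewrite -normrZ -linearZ; apply: le_opnorm_unit.
by rewrite normrZ ger0_norm ?invr_ge0 // mulVf // normr_eq0.
Qed.

Let opnormD (S T : bop) : opnorm (S + T) <= opnorm S + opnorm T.
Proof.
apply: opnorm_le => x x1; rewrite bopD (le_trans (ler_normD _ _)) //.
by rewrite lerD // le_opnorm_unit.
Qed.

Let opnormZ_le a (T : bop) : opnorm (a *: T) <= `|a| * opnorm T.
Proof.
by apply: opnorm_le => x x1; rewrite bopZ normrZ ler_wpM2l // le_opnorm_unit.
Qed.

Let opnormZ a (T : bop) : opnorm (a *: T) = `|a| * opnorm T.
Proof.
apply/eqP; rewrite eq_le opnormZ_le /=.
have [->|a0] := eqVneq a 0.
  by rewrite normr0 mul0r (le_trans _ (@le_opnorm_unit _ 0 _)) ?normr0.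
rewrite -ler_pdivlMl ?normr_gt0 // -normfV.
by rewrite -{1}[T](scalerK a0) opnormZ_le.
Qed.

Let opnorm0_eq0 (T : bop) : opnorm T = 0 -> T = 0.
Proof.
move=> T0; apply/bopP => x; apply/eqP; rewrite -normr_le0.
by rewrite (le_trans (le_opnorm T x)) // T0 mul0r.
Qed.
HB.instance Definition _ :=
  Lmodule_isNormed.Build C bop opnormD opnormZ opnorm0_eq0.

Lemma bop_norm_le (T : bop) x : `|T x| <= `|T| * `|x|.
Proof. exact: le_opnorm. Qed.

End BoundedOperators.

Notation "''L' ( H , K )" := (bop H K)
  (at level 8, format "''L' ( H ,  K )") : type_scope.

Section OperatorAlgebra.
Variable R : realType.
Implicit Types H K L : hilbertType R.

Lemma bounded_linear_id H : bounded_linear (@idfun H).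
Proof. by split=> //; exists 1 => x; rewrite mul1r. Qed.
Definition opid H : 'L(H, H) := Bop (asboolT (bounded_linear_id H)).

Lemma bounded_linear_comp H K L (S : 'L(K, L)) (T : 'L(H, K)) :
  bounded_linear (S \o T).
Proof.
split=> [a x y|]; first by rewrite /= !linearP.
have [[M M0 leM] [N _ leN]] := (bop_bounded S, bop_bounded T).
exists (M * N) => x; rewrite (le_trans (leM _)) // -mulrA.
by rewrite ler_wpM2l.
Qed.
Definition opcomp H K L (S : 'L(K, L)) (T : 'L(H, K)) : 'L(H, L) :=
  Bop (asboolT (bounded_linear_comp S T)).

(* The T' such that <T x, y> = <x, T' y>, which exists and is unique by the
   Riesz representation theorem. *)
Definition adj H K (T : 'L(H, K)) : 'L(K, H) :=
  xget 0 [set T' : 'L(K, H) | forall x y, inner (T x) y = inner x (T' y)].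

(* The two-sided bounded inverse, and 0 when there is none. *)
Definition opinv H (T : 'L(H, H)) : 'L(H, H) :=
  xget 0 [set T' : 'L(H, H) | opcomp T' T = opid H /\ opcomp T T' = opid H].

Definition contractive H K (T : 'L(H, K)) : Prop := forall x, `|T x| <= `|x|.

Definition isometric_on H K (T : 'L(H, K)) (E : set H) : Prop :=
  forall x, E x -> `|T x| = `|x|.

Definition closed_span H (E : set H) : set H :=
  closure [set v | exists n (a : 'I_n -> R[i]) (w : 'I_n -> H),
    (forall i, E (w i)) /\ v = \sum_(i < n) a i *: w i].

End OperatorAlgebra.

Notation "S *o T" := (opcomp S T) (at level 40, left associativity).
Notation "T ^#" := (adj T) (at level 2, format "T ^#").

Section Blocks.
Variables (R : realType) (d : nat).
Implicit Types H K U X Y : hilbertType R.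
Local Notation C := R[i].

Lemma hsum_norm_le H K (p : hsum H K) : `|p| <= `|p.1| + `|p.2|.
Proof.
rewrite -ler_sqr ?nnegrE ?addr_ge0 // norm_inner hsum_innerE -!norm_inner.
by rewrite sqrrD addrAC lerDl mulrn_wge0 // mulr_ge0.
Qed.

Lemma hsum_norm1_le H K (p : hsum H K) : `|p.1| <= `|p|.
Proof.
rewrite -ler_sqr ?nnegrE // norm_inner [leRHS]norm_inner hsum_innerE.
by rewrite lerDl -norm_inner exprn_ge0.
Qed.

Lemma hsum_norm2_le H K (p : hsum H K) : `|p.2| <= `|p|.
Proof.
rewrite -ler_sqr ?nnegrE // norm_inner [leRHS]norm_inner hsum_innerE.
by rewrite lerDr -norm_inner exprn_ge0.
Qed.

Lemma hpow_norm_coord_le H (p : hpow d H) j : `|p j| <= `|p|.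
Proof.
rewrite -ler_sqr ?nnegrE // norm_inner [leRHS]norm_inner hpow_innerE.
by rewrite (bigD1 j) //= lerDl sumr_ge0 // => k _; rewrite -norm_inner exprn_ge0.
Qed.

Lemma hpow_norm_le H (p : hpow d H) : `|p| <= \sum_(j < d) `|p j|.
Proof.
rewrite -ler_sqr ?nnegrE ?sumr_ge0 // norm_inner hpow_innerE.
rewrite expr2 mulr_suml ler_sum // => j _.
by rewrite -norm_inner expr2 ler_wpM2l // (bigD1 j) //= lerDl sumr_ge0.
Qed.

Definition colop_fun H K (T : 'I_d -> 'L(H, K)) (x : H) : hpow d K :=
  fun j => T j x.

Lemma bounded_linear_col H K (T : 'I_d -> 'L(H, K)) :
  bounded_linear (colop_fun T).
Proof.
split=> [a x y|]; first by apply/funext => j; exact: linearP.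
exists (\sum_(j < d) `|T j|) => x; rewrite (le_trans (hpow_norm_le _)) //.
by rewrite mulr_suml ler_sum // => j _; exact: bop_norm_le.
Qed.
Definition colop H K (T : 'I_d -> 'L(H, K)) : 'L(H, hpow d K) :=
  Bop (asboolT (bounded_linear_col T)).

(* C^d with its Hilbert space structure; inner l z is the sum of the
   l_j times the conjugate of z_j. *)
Definition Cpow : hilbertType R := hpow d (hscalar R).

Definition unit_ball : set Cpow := [set l | `|l| < 1].

Definition Zfun H (l : Cpow) (x : hpow d H) : H :=
  \sum_(j < d) (l j : C) *: x j.

Lemma bounded_linear_Z H (l : Cpow) : bounded_linear (@Zfun H l).
Proof.
split=> [a x y|].
  rewrite /Zfun scaler_sumr -big_split /=; apply: eq_bigr => j _.
  by rewrite scalerDr !scalerA mulrC.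
exists (\sum_(j < d) `|l j|) => x; rewrite (le_trans (ler_norm_sum _ _ _)) //.
rewrite mulr_suml ler_sum // => j _.
by rewrite normrZ ler_wpM2l // hpow_norm_coord_le.
Qed.
Definition Zop H (l : Cpow) : 'L(hpow d H, H) :=
  Bop (asboolT (@bounded_linear_Z H l)).

Definition block_fun X U Y (K : hilbertType R) (A : 'L(X, K)) (B : 'L(U, K))
    (C : 'L(X, Y)) (D : 'L(U, Y)) (p : hsum X U) : hsum K Y :=
  (A p.1 + B p.2, C p.1 + D p.2).

Lemma bounded_linear_block X U Y K (A : 'L(X, K)) (B : 'L(U, K))
    (C : 'L(X, Y)) (D : 'L(U, Y)) : bounded_linear (block_fun A B C D).
Proof.
split=> [a p q|].
  rewrite /block_fun /= !linearP /= addrACA -scalerDr.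
  by rewrite [X in (_, X) = _]addrACA -[X in (_, X + _) = _]scalerDr.
exists ((`|A| + `|B|) + (`|C| + `|D|)) => p.
have leT V W (T : 'L(V, W)) v (r : R[i]) : `|v| <= r -> `|T v| <= `|T| * r.
  by move=> vr; rewrite (le_trans (bop_norm_le T v)) // ler_wpM2l.
rewrite (le_trans (hsum_norm_le _)) // !mulrDl lerD //;
  by rewrite (le_trans (ler_normD _ _)) // lerD // leT //
    ?hsum_norm1_le ?hsum_norm2_le.
Qed.
Definition block X U Y K (A : 'L(X, K)) (B : 'L(U, K))
    (C : 'L(X, Y)) (D : 'L(U, Y)) : 'L(hsum X U, hsum K Y) :=
  Bop (asboolT (bounded_linear_block A B C D)).

End Blocks.

(* A reproducing kernel Hilbert space with kernel k on Om is a Hilbert space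
   together with an identification, by rkhs_eval, of its elements with functions
   on Om. Values of rkhs_eval outside Om carry no meaning. *)
Record rkhs (R : realType) (T : Type) (Om : set T) (k : T -> T -> R[i]) := Rkhs {
  rkhs_space :> hilbertType R ;
  rkhs_eval : rkhs_space -> T -> R[i] ;
  rkhs_eval_linear : forall (a : R[i]) f g t, Om t ->
    rkhs_eval (a *: f + g) t = a * rkhs_eval f t + rkhs_eval g t ;
  rkhs_eval_inj : forall f, (forall t, Om t -> rkhs_eval f t = 0) -> f = 0 ;
  rkhs_reproducing : forall z, Om z -> exists kz : rkhs_space,
    (forall t, Om t -> rkhs_eval kz t = k t z) /\
    (forall f, rkhs_eval f z = inner f kz)
}.

(* The Hilbert space tensor product of H and Y, with its elements viewed as
   Y-valued functions on Om, so that f (x) y is the function t |-> f t *: y;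
   continuity of the evaluations determines the function of a general element
   from those of the elementary tensors. *)
Record rkhs_tensor (R : realType) (T : Type) (Om : set T) (k : T -> T -> R[i])
    (H : rkhs Om k) (Y : hilbertType R) := RkhsTensor {
  rt_space :> hilbertType R ;
  rt_tensor : {bilinear H -> Y -> rt_space} ;
  rt_inner : forall f g y z,
    inner (rt_tensor f y) (rt_tensor g z) = inner f g * inner y z ;
  rt_total : closed_span [set w | exists f y, w = rt_tensor f y] = setT ;
  rt_eval : rt_space -> T -> Y ;
  rt_eval_bounded : forall t, Om t -> bounded_linear (rt_eval ^~ t) ;
  rt_eval_tensor : forall f y t, Om t ->
    rt_eval (rt_tensor f y) t = rkhs_eval f t *: y
}.

Section SchurClass.
Variables (R : realType) (d : nat).
Implicit Types U X Y : hilbertType R.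
Local Notation C := R[i].
Local Notation Cd := (Cpow R d).
Local Notation Bd := (@unit_ball R d).

Definition drury_arveson_kernel (l z : Cd) : C := (1 - inner l z)^-1.

(* Operator-valued functions on the ball are given on all of C^d; only their
   values on the ball are ever used. Differentiability is complex Frechet
   differentiability for the operator norm, the scalars being R[i]. *)
Definition analytic_on_ball U Y (S : Cd -> 'L(U, Y)) : Prop :=
  forall l, Bd l -> differentiable S l.

Definition contractive_multiplier U Y (H : rkhs Bd drury_arveson_kernel)
    (HU : rkhs_tensor H U) (HY : rkhs_tensor H Y) (S : Cd -> 'L(U, Y)) : Prop :=
  forall f : HU, exists g : HY,
    (forall l, Bd l -> rt_eval g l = S l (rt_eval f l)) /\ `|g| <= `|f|.

(* H, HU and HY are determined up to a unitary map preserving evaluations. *)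
Definition schur_class U Y (S : Cd -> 'L(U, Y)) : Prop :=
  analytic_on_ball S /\
  forall (H : rkhs Bd drury_arveson_kernel)
      (HU : rkhs_tensor H U) (HY : rkhs_tensor H Y),
    contractive_multiplier HU HY S.

Definition K_S U Y (S : Cd -> 'L(U, Y)) (l z : Cd) : 'L(Y, Y) :=
  (1 - inner l z)^-1 *: (opid Y - S l *o (S z)^#).

Definition K_CA X Y (C : 'L(X, Y)) (A : 'I_d -> 'L(X, X)) (l z : Cd) : 'L(Y, Y) :=
  C *o opinv (opid X - \sum_(j < d) (l j : R[i]) *: A j)
    *o opinv (opid X - \sum_(j < d) (z j : R[i])^* *: (A j)^#) *o C^#.

Section Realization.
Variables (X U Y : hilbertType R).
Variables (A : 'I_d -> 'L(X, X)) (B : 'I_d -> 'L(U, X)).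
Variables (C : 'L(X, Y)) (D : 'L(U, Y)).

Definition connecting_op : 'L(hsum X U, hsum (hpow d X) Y) :=
  block (colop A) (colop B) C D.

Definition transfer_function (l : Cd) : 'L(U, Y) :=
  D + C *o opinv (opid X - Zop X l *o colop A) *o Zop X l *o colop B.

Definition realizes (S : Cd -> 'L(U, Y)) : Prop :=
  forall l, Bd l -> S l = transfer_function l.

Definition D_space : set (hpow d X) :=
  closed_span [set h | exists z y, Bd z /\
    h = ((Zop X z)^# *o opinv (opid X - (colop A)^# *o (Zop X z)^#) *o C^#) y].

Definition contractive_realization : Prop := contractive connecting_op.

Definition weakly_coisometric : Prop :=
  contractive connecting_op^# /\
  isometric_on connecting_op^#
    [set w : hsum (hpow d X) Y | D_space w.1].

End Realization.
End SchurClass.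

(* Main.v *)
(* Put g = (I - A^* Z(z)^* )^-1 C^* y and h = Z(z)^* g. Then g = C^* y + A^* h, so
   the adjoint of the connecting operator maps (h, y) to (g, S(z)^* y). Since
   <Z(z)^* g, Z(l)^* g'> = <l, z> <g, g'>, the identity K_S(l, z) = K_CA(l, z)
   says exactly that this adjoint preserves the inner product of the vectors
   (h, y) attached to z and l. These vectors span a dense subspace of D (+) Y:
   the point z = 0 contributes all the vectors (0, y). *)
Require Import Defs.
From mathcomp Require Import all_boot all_order all_algebra complex.
From mathcomp Require Import boolp classical_sets reals topology normedtype.
From mathcomp Require Import sesquilinear ring.

Set Implicit Arguments.
Unset Strict Implicit.
Unset Printing Implicit Defensive.

Import Order.TTheory GRing.Theory Num.Theory.

Local Open Scope classical_set_scope.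
Local Open Scope ring_scope.

(** * Inner product calculus *)

Section InnerProduct.
Variables (R : realType) (H : hilbertType R).
Implicit Types (x y z v : H) (a : R[i]).

Lemma innerC x y : inner x y = (inner y x)^*.
Proof. by rewrite (hermC inner) expr0 mul1r. Qed.

Lemma innerDl x y z : inner (x + y) z = inner x z + inner y z.
Proof. exact: linearDl. Qed.

Lemma innerDr z x y : inner z (x + y) = inner z x + inner z y.
Proof. exact: linearDr. Qed.

Lemma innerBl x y z : inner (x - y) z = inner x z - inner y z.
Proof. exact: linearBl. Qed.

Lemma innerBr z x y : inner z (x - y) = inner z x - inner z y.
Proof. exact: linearBr. Qed.

Lemma innerZl a x y : inner (a *: x) y = a * inner x y.
Proof. by rewrite linearZl_LR. Qed.

Lemma innerZr a x y : inner x (a *: y) = a^* * inner x y.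
Proof. by rewrite linearZr_LR. Qed.

Lemma inner_suml (I : Type) (r : seq I) (P : pred I) (F : I -> H) y :
  inner (\sum_(i <- r | P i) F i) y = \sum_(i <- r | P i) inner (F i) y.
Proof. exact: linear_sumlz. Qed.

Lemma norm_sqr_inner x : `|x| ^+ 2 = inner x x.
Proof. exact: norm_inner. Qed.

Lemma norm_inner_le x y : `|inner x y| <= `|x| * `|y|.
Proof.
rewrite -ler_sqr ?nnegrE ?mulr_ge0 // exprMn !norm_inner.
exact: dot_CauchySchwarz.
Qed.

Lemma inner_inj x y : (forall z, inner z x = inner z y) -> x = y.
Proof.
move=> xy; apply/subr0_eq/eqP; rewrite -(dnorm_eq0 inner).
by rewrite innerBr xy subrr.
Qed.

End InnerProduct.

(** * Approximate minimisers and Riesz representation *)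

Lemma almost_minimizer (R : realType) (T : Type) (phi : T -> R[i]) (x0 : T)
    (e : R[i]) :
  (forall x, 0 <= phi x) -> 0 < e -> exists x, forall y, phi x <= phi y + e.
Proof.
(* Nonnegative elements of [R[i]] are real, so the infimum can be taken over real parts in [R]. *)
move=> phi0 e0; have ReE x : phi x = (complex.Re (phi x))%:C%C.
  by rewrite RRe_real ?ger0_real.
have eE : e = (complex.Re e)%:C%C by rewrite RRe_real ?ger0_real ?ltW.
pose E := [set complex.Re (phi x) | x in setT].
have hE : has_inf E.
  split; first by exists (complex.Re (phi x0)); exists x0.
  by exists 0 => _ [x _ <-]; rewrite -lecR -ReE.
have [|_ [x _ <-] xE] := @inf_adherent _ E (complex.Re e) _ hE.
  by rewrite -ltcR -eE.
exists x => y; rewrite ReE (ReE y) eE -rmorphD lecR (le_trans (ltW xE)) //.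
by rewrite lerD2r; apply: ge_inf; [case: hE | exists y].
Qed.

(** Cantor's intersection argument: the nested sets generate a Cauchy filter because their diameters
    tend to 0. As [P e] may fail to be closed, the limit is only asserted to be near it. *)
Lemma shrinking_sets_limit (R : realType) (H : hilbertType R)
    (P : R[i] -> set H) (K : R[i]) :
  0 < K ->
  (forall e, 0 < e -> P e !=set0) ->
  (forall e e', 0 < e -> e <= e' -> P e `<=` P e') ->
  (forall e x y, 0 < e -> P e x -> P e y -> `|x - y| <= K * e) ->
  exists l, forall e, 0 < e -> exists2 x, P e x & `|l - x| < e.
Proof.
move=> K0 P0 Pmono Pdiam.
have PF : ProperFilter (filter_from [set e : R[i] | 0 < e] P).
  apply: filter_from_proper => //; apply: filter_from_filter.
    by exists 1; rewrite /= ltr01.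
  move=> e e' /= e0 e'0.
  (* The order of [R[i]] is partial, but positive elements are real and hence comparable. *)
  have /orP[ee'|e'e] : (e <= e') || (e' <= e).
    by apply: real_comparable; exact: gtr0_real.
    by exists e => // x Px; split=> //; exact: Pmono ee' _ Px.
  by exists e' => // x Px; split=> //; exact: Pmono e'e _ Px.
have [|l Pl] := @hilbert_complete R H _ PF.
  move=> e e0; have e1 : 0 < e / (2 * K) by rewrite divr_gt0 ?mulr_gt0.
  have [x Px] := P0 _ e1; exists x; exists (e / (2 * K)) => // y Py /=.
  apply: le_lt_trans (Pdiam _ _ _ e1 Px Py) _.
  have -> : K * (e / (2 * K)) = e / 2.
    by field; rewrite (gt_eqF K0).
  by rewrite ltr_pdivrMr // ltr_pMr // ltr1n.
exists l => e e0; have [e' /= e'0 sub] := Pl e e0.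
have /orP[ee'|e'e] : (e <= e') || (e' <= e).
  by apply: real_comparable; exact: gtr0_real.
- by have [x Px] := P0 e e0; exists x => //; apply/sub/Pmono/Px.
- by have [x Px] := P0 e' e'0; exists x; [exact: Pmono e'e _ Px | exact: sub].
Qed.

Lemma eq0_of_le_eps (R : realType) (x : R[i]) (K : R[i]) :
  0 <= x -> (forall e : R[i], 0 < e -> x <= K * e) -> x = 0.
Proof.
move=> x0 xe; apply/eqP/negPn/negP => nx.
have xgt0 : 0 < x by rewrite lt_def nx.
have K0 : 0 < K.
  by have := xe 1 ltr01; rewrite mulr1; apply: lt_le_trans.
have := xe (x / (2 * K)) (divr_gt0 xgt0 (mulr_gt0 (ltr0Sn _ 1) K0)).
have -> : K * (x / (2 * K)) = x / 2 by field; rewrite (gt_eqF K0).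
by rewrite ler_pdivlMr ?ltr0Sn // ger_pMr // lern1.
Qed.

(** Variational proof: a minimiser of |x|^2 - 2 Re f(x) represents f, and near-minimisers represent
    it up to a small error. The sets [P e] of approximate representers shrink to the exact one. *)
Lemma Riesz (R : realType) (H : hilbertType R) (f : H -> R[i]) (M : R[i]) :
  0 <= M ->
  (forall a x y, f (a *: x + y) = a * f x + f y) ->
  (forall x, `|f x| <= M * `|x|) ->
  exists l, forall x, f x = inner x l.
Proof.
move=> M0 flin fM.
have f0 : f 0 = 0.
  have := flin 1 0 0; rewrite scaler0 addr0 mul1r => /(congr1 (fun t => t - f 0)).
  by rewrite subrr addrK.
(* The constant M^2 makes [phi] dominate (|x| - M)^2, so it is nonnegative, as [almost_minimizer]
   requires. *)
pose phi x := `|x| ^+ 2 - (f x + (f x)^*) + M ^+ 2.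
have phi_ge0 x : 0 <= phi x.
  have fx : f x + (f x)^* <= 2 * (M * `|x|).
    have -> : f x + (f x)^* = 'Re (f x) *+ 2.
      by rewrite ReE -mulr_natr divfK // pnatr_eq0.
    rewrite mulr_natl lerMn2r /= (le_trans _ (fM x)) //.
    by rewrite (leif_Re_Creal _).1.
  have -> : phi x = (`|x| - M) ^+ 2 + (2 * (M * `|x|) - (f x + (f x)^*)).
    by rewrite /phi; ring.
  by rewrite addr_ge0 ?subr_ge0 // real_exprn_even_ge0 // rpredB //
    ?normr_real ?ger0_real.
pose P (e : R[i]) : set H := [set x | forall v, `|f v - inner v x| <= e * `|v|].
have [|e e0|e e' e0 ee' x Px v|e x y e0 Px Py|l Pl] :=
    @shrinking_sets_limit R H P 2.
- by rewrite ltr0Sn.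
- have [x minx] := almost_minimizer 0 phi_ge0 (exprn_gt0 2 e0).
  (* Moving x along v by s changes phi by - |f v - <v, x>|^2 / <v, v>. *)
  exists x => v; have [->|v0] := eqVneq v 0.
    by rewrite f0 linear0l subrr !normr0 mulr0.
  set D := f v - inner v x.
  have vv0 : 0 < inner v v by rewrite dnorm_gt0.
  have [s sE sC] : exists2 s, s = D^* / inner v v & s^* = D / inner v v.
    exists (D^* / inner v v) => //.
    by rewrite rmorphM fmorphV /= conjCK -(innerC v v).
  have := minx (s *: v + x).
  rewrite /phi !norm_sqr_inner flin innerDl !innerDr !innerZl !innerZr.
  rewrite (innerC x v).
  have -> : f v = D + inner v x by rewrite /D subrK.
  rewrite !rmorphD !rmorphM rmorphD /= sC.
  set q := inner v x; set p := q^*; set Dc := D^*.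
  rewrite sE -/Dc -subr_ge0.
  set t := (X in 0 <= X).
  have -> : t = e ^+ 2 - D * Dc / inner v v.
    by rewrite /t; field; rewrite gt_eqF.
  (* The decrease |D|^2 / <v, v> is at most the tolerance e^2, that is, |D| <= e |v|. *)
  rewrite -normCK subr_ge0 ler_pdivrMr // -norm_sqr_inner -exprMn.
  by rewrite ler_sqr ?nnegrE ?mulr_ge0 // ltW.
- by rewrite (le_trans (Px v)) // ler_wpM2r.
(* Testing both memberships on v = x - y gives |x - y|^2 <= 2 e |x - y|. *)
- have [->|xy] := eqVneq x y; first by rewrite subrr normr0 mulr_ge0 ?ltW.
  have nxy : 0 < `|x - y| by rewrite normr_gt0 subr_eq0.
  rewrite -(ler_pM2r nxy) -expr2 norm_sqr_inner.
  rewrite -[leLHS]ger0_norm ?dnorm_ge0 // innerBr.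
  set w := x - y.
  have -> : inner w x - inner w y = (f w - inner w y) - (f w - inner w x).
    by ring.
  rewrite (le_trans (ler_normB _ _)) // -mulrA mulr_natl mulr2n.
  by rewrite lerD.
- exists l => v; apply/subr0_eq/eqP; rewrite -normr_eq0; apply/eqP.
  apply: (@eq0_of_le_eps _ _ (2 * `|v|)) => // e e0.
  have [x Px lx] := Pl e e0.
  have -> : f v - inner v l = (f v - inner v x) - inner v (l - x).
    by rewrite innerBr; ring.
  rewrite (le_trans (ler_normB _ _)) // -mulrA mulr_natl mulr2n lerD //.
    by rewrite mulrC.
  by rewrite (le_trans (norm_inner_le _ _)) // ler_wpM2l // ltW.
Qed.

(** * Adjoints of bounded operators *)

Section Adjoint.
Variable R : realType.
Implicit Types H K L : hilbertType R.

Lemma bopB H K (S T : 'L(H, K)) x : (S - T) x = S x - T x.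
Proof. by []. Qed.

Lemma bop_sum H K (I : Type) (r : seq I) (F : I -> 'L(H, K)) x :
  (\sum_(j <- r) F j) x = \sum_(j <- r) F j x.
Proof. by elim/big_rec2: _ => //= i u v _ <-. Qed.

(** Riesz represents each functional <T x, y> by a vector f y. Uniqueness of the representer makes f
    linear, and |f y|^2 = <T (f y), y> bounds it by |T|. *)
Lemma adj_exists H K (T : 'L(H, K)) :
  exists T' : 'L(K, H), forall x y, inner (T x) y = inner x (T' y).
Proof.
have /choice[f fE] (y : K) : exists l : H, forall x, inner (T x) y = inner x l.
  apply: (@Riesz _ _ (fun x => inner (T x) y) (`|T| * `|y|)) => [|a u v|x].
  - by rewrite mulr_ge0.
  - by rewrite linearP innerDl innerZl.
  - by rewrite (le_trans (norm_inner_le _ _)) // mulrAC ler_wpM2r ?bop_norm_le.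
have bf : bounded_linear f.
  split=> [a u v|].
    apply: inner_inj => z.
    by rewrite -fE !innerDr !innerZr !fE.
  exists `|T| => y; have [->|fy0] := eqVneq (f y) 0.
    by rewrite normr0 mulr_ge0.
  have fy : 0 < `|f y| by rewrite normr_gt0.
  rewrite -(ler_pM2r fy) -expr2 norm_sqr_inner -fE.
  rewrite -[leLHS]ger0_norm; last by rewrite fE dnorm_ge0.
  rewrite (le_trans (norm_inner_le _ _)) // mulrAC ler_wpM2r //.
  exact: bop_norm_le.
by exists (Bop (asboolT bf)).
Qed.

Lemma inner_adj H K (T : 'L(H, K)) x y : inner (T x) y = inner x (T^# y).
Proof.
have [T' T'E] := adj_exists T.
by rewrite /adj; case: xgetP => [T'' _ |/(_ T')]; [exact|case].
Qed.

Lemma adj_unique H K (T : 'L(H, K)) (T' : 'L(K, H)) :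
  (forall x y, inner (T x) y = inner x (T' y)) -> T^# = T'.
Proof.
by move=> T'E; apply/bopP => y; apply: inner_inj => x; rewrite -inner_adj.
Qed.

Lemma adj_id H : (opid H)^# = opid H.
Proof. exact: adj_unique. Qed.

Lemma adj_comp H K L (S : 'L(K, L)) (T : 'L(H, K)) : (S *o T)^# = T^# *o S^#.
Proof. by apply: adj_unique => x y /=; rewrite !inner_adj. Qed.

Lemma adjD H K (S T : 'L(H, K)) : (S + T)^# = S^# + T^#.
Proof. by apply: adj_unique => x y; rewrite !bopD innerDl innerDr !inner_adj. Qed.

Lemma adjB H K (S T : 'L(H, K)) : (S - T)^# = S^# - T^#.
Proof.
apply: adj_unique => x y.
by rewrite !bopB innerBl innerBr !inner_adj.
Qed.

(** Cauchy-Schwarz applied to |T^# y|^2 = <T (T^# y), y>. *)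
Lemma contractive_adj H K (T : 'L(H, K)) : contractive T -> contractive T^#.
Proof.
move=> cT y; have [->|Ty0] := eqVneq (T^# y) 0; first by rewrite normr0.
have Ty : 0 < `|T^# y| by rewrite normr_gt0.
rewrite -(ler_pM2l Ty) -expr2 norm_sqr_inner -inner_adj.
rewrite -[leLHS]ger0_norm; last by rewrite inner_adj dnorm_ge0.
by rewrite (le_trans (norm_inner_le _ _)) // ler_wpM2r.
Qed.

End Adjoint.

(** * Inverses and the invertibility of I - T *)

Section Inverse.
Variables (R : realType) (H : hilbertType R).
Implicit Types T G : 'L(H, H).

Definition op_invertible T :=
  exists G, opcomp G T = opid H /\ opcomp T G = opid H.

(** Two-sided inverses are unique, so any inverse at hand is the one chosen by [opinv], and its
    default 0 does not arise. *)
Lemma opinv_unique T G :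
  opcomp G T = opid H -> opcomp T G = opid H -> opinv T = G.
Proof.
move=> GT TG; rewrite /opinv; case: xgetP => [G' _ [G'T TG']|]; last first.
  by move=> /(_ G) [].
apply/bopP => x.
have <- : (G *o T) (G' x) = G x by rewrite /= -[T (G' x)]/((T *o G') x) TG'.
by rewrite GT.
Qed.

Lemma opinvP T : op_invertible T ->
  opcomp (opinv T) T = opid H /\ opcomp T (opinv T) = opid H.
Proof. by case=> G [GT TG]; rewrite (opinv_unique GT TG). Qed.

Lemma opinvK T x : op_invertible T -> T (opinv T x) = x.
Proof. by move=> /opinvP[_ /bopP/(_ x)]. Qed.

Lemma opinv_adj T : op_invertible T -> opinv T^# = (opinv T)^#.
Proof.
move=> /opinvP[iT Ti].
by apply: opinv_unique; rewrite -adj_comp ?iT ?Ti adj_id.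
Qed.

Lemma invertible_adj T : op_invertible T -> op_invertible T^#.
Proof.
move=> /opinvP[iT Ti].
by exists (opinv T)^#; rewrite -!adj_comp iT Ti adj_id.
Qed.

(** Instead of summing a series: W = I - T is bounded below by 1 - q, hence injective, and the sets
    of x with residual |y - W x| at most e shrink to a solution of W x = y. *)
Lemma Neumann T (q : R[i]) : 0 <= q -> q < 1 ->
  (forall x, `|T x| <= q * `|x|) -> op_invertible (opid H - T).
Proof.
move=> q0 q1 Tq; have q'0 : 0 < 1 - q by rewrite subr_gt0.
set W := opid H - T; have WE x : W x = x - T x by [].
clearbody W.
have WP a x y : W (a *: x + y) = a *: W x + W y by exact: linearP.
have WD x y : W (x + y) = W x + W y by exact: linearD.
have WB x y : W (x - y) = W x - W y by exact: linearB.
have lower x : (1 - q) * `|x| <= `|W x|.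
  rewrite mulrBl mul1r lerBlDr.
  rewrite -{1}[x](subrK (T x)) -WE.
  by rewrite (le_trans (ler_normD _ _)) // lerD2l.
have Winj x y : W x = W y -> x = y.
  move=> xy; apply/subr0_eq/eqP; rewrite -normr_le0.
  by rewrite -(pmulr_rle0 _ q'0) (le_trans (lower _)) // WB xy subrr normr0.
have /choice[g gE] y : exists x, W x = y.
  pose P (e : R[i]) : set H := [set x | `|y - W x| <= e].
  have [|e e0|e e' e0 ee' x Px|e u v e0 Pu Pv|l Pl] :=
      @shrinking_sets_limit R H P (2 / (1 - q)).
  - by rewrite divr_gt0.
  - have [x xmin] := @almost_minimizer R H (fun x => `|y - W x|) 0
      (e * (1 - q)) (fun=> normr_ge0 _) (mulr_gt0 e0 q'0).
    (* Adding the residual r to x replaces it by the residual T r. *)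
    exists x; rewrite /P /=; set r := y - W x.
    have := xmin (x + r); rewrite -/r.
    have -> : y - W (x + r) = T r.
      by rewrite WD opprD addrA -/r WE opprB addrCA subrr addr0.
    (* Near-minimality gives |r| <= q |r| + e (1 - q), hence |r| <= e; this fixes the tolerance e (1
       - q). *)
    move=> rT; rewrite -(ler_pM2r q'0) [leLHS]mulrBr mulr1 lerBlDr.
    by rewrite (le_trans rT) // addrC lerD2l mulrC Tq.
  - exact: le_trans Px ee'.
  - rewrite mulrAC ler_pdivlMr // mulrC (le_trans (lower _)) // WB.
    have -> : W u - W v = (y - W v) - (y - W u) by rewrite opprB [RHS]addrC subrKA.
    by rewrite (le_trans (ler_normB _ _)) // mulr_natl mulr2n lerD.
  - exists l; apply/esym/subr0_eq/eqP; rewrite -normr_eq0; apply/eqP.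
    (* The first 1 bounds the residual at x, and 1 + q bounds W on l - x. *)
    apply: (@eq0_of_le_eps _ _ (1 + (1 + q))) => // e e0.
    have [x Px lx] := Pl e e0.
    have -> : y - W l = (y - W x) - W (l - x) by rewrite WB opprB addrA subrK.
    rewrite (le_trans (ler_normB _ _)) // mulrDl mul1r lerD //.
    rewrite WE (le_trans (ler_normB _ _)) // mulrDl mul1r lerD //; first exact: ltW.
    by rewrite (le_trans (Tq _)) // ler_wpM2l // ltW.
have bg : bounded_linear g.
  split=> [a x y|]; first by apply: Winj; rewrite WP !gE.
  exists (1 - q)^-1 => y.
  by rewrite mulrC ler_pdivlMr // mulrC -{2}(gE y).
exists (Bop (asboolT bg)); split; apply/bopP => x /=; last exact: gE.
by apply: Winj; rewrite gE.
Qed.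

End Inverse.

(** * The row operator Z(l) and its adjoint *)

Section RowOperator.
Variables (R : realType) (d : nat) (X : hilbertType R).
Implicit Types (l z : Cpow R d) (A : 'I_d -> 'L(X, X)).

Lemma adj_Zop z (g : X) : (Zop X z)^# g = (fun j => (z j : R[i])^* *: g).
Proof.
apply: inner_inj => x; rewrite -inner_adj /= /Zfun inner_suml hpow_innerE.
by apply: eq_bigr => j _; rewrite innerZl innerZr conjCK.
Qed.

Lemma Zop_adj_Zop l z (g : X) : Zop X l ((Zop X z)^# g) = inner l z *: g.
Proof.
rewrite adj_Zop /= /Zfun hpow_innerE scaler_suml.
by apply: eq_bigr => j _; rewrite scalerA.
Qed.

Lemma inner_adj_Zop l z (g g' : X) :
  inner ((Zop X z)^# g) ((Zop X l)^# g') = inner l z * inner g g'.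
Proof. by rewrite -inner_adj Zop_adj_Zop innerZl. Qed.

(** The adjoint of Z(l) multiplies norms by exactly |l|; the bound passes to Z(l) by
    Cauchy-Schwarz. *)
Lemma norm_Zop_le l x : `|Zop X l x| <= `|l| * `|x|.
Proof.
have nZ g : `|(Zop X l)^# g| = `|l| * `|g|.
  apply/eqP; rewrite -(eqrXn2 (n := 2)) ?mulr_ge0 // exprMn.
  by rewrite !norm_sqr_inner inner_adj_Zop.
have [->|Zx0] := eqVneq (Zop X l x) 0; first by rewrite normr0 mulr_ge0.
have Zx : 0 < `|Zop X l x| by rewrite normr_gt0.
rewrite -(ler_pM2r Zx) -expr2 norm_sqr_inner.
rewrite -[leLHS]ger0_norm ?dnorm_ge0 // inner_adj (le_trans (norm_inner_le _ _)) //.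
by rewrite nZ mulrCA mulrA.
Qed.

(** [K_CA] writes its resolvents with sums, [transfer_function] and [D_space] with the row operator;
    this identity and its adjoint reconcile them. *)
Lemma Zop_colop A l :
  Zop X l *o colop A = \sum_(j < d) (l j : R[i]) *: A j.
Proof.
by apply/bopP => x; rewrite /= /Zfun /colop_fun bop_sum.
Qed.

Lemma adj_Zop_colop A z :
  (colop A)^# *o (Zop X z)^# = \sum_(j < d) (z j : R[i])^* *: (A j)^#.
Proof.
rewrite -adj_comp Zop_colop; apply: adj_unique => x y.
rewrite !bop_sum inner_suml innerC inner_suml rmorph_sum.
apply: eq_bigr => j _; rewrite !bopZ !innerZl rmorphM /= conjCK inner_adj.
by rewrite -innerC.
Qed.

Lemma one_sub_inner_neq0 l z : unit_ball l -> unit_ball z -> 1 - inner l z != 0.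
Proof.
move=> l1 z1; rewrite subr_eq0 eq_sym; apply: contraTneq isT => lz.
have := norm_inner_le l z; rewrite lz normr1.
move=> /le_lt_trans/(_ (mulr_ilt1 _ _ l1 z1)); rewrite !normr_ge0 ltxx.
by move=> /(_ isT isT).
Qed.

Lemma invertible_one_sub_Zop_colop A l : contractive (colop A) -> unit_ball l ->
  op_invertible (opid X - Zop X l *o colop A).
Proof.
move=> cA l1; apply: (@Neumann _ _ _ `|l|) => // x.
by rewrite (le_trans (norm_Zop_le _ _)) // ler_wpM2l.
Qed.

End RowOperator.

(** * The adjoint of the connecting operator on D (+) Y *)

Lemma inner_K_S (R : realType) (d : nat) (U Y : hilbertType R)
    (S : Cpow R d -> 'L(U, Y)) l z y y' :
  inner (K_S S l z y) y' =
  (1 - inner l z)^-1 * (inner y y' - inner ((S z)^# y) ((S l)^# y')).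
Proof. by rewrite /K_S bopZ innerZl bopB innerBl /= (inner_adj (S l)). Qed.

Section Colligation.
Variables (R : realType) (d : nat) (X U Y : hilbertType R).
Variables (A : 'I_d -> 'L(X, X)) (B : 'I_d -> 'L(U, X)).
Variables (C : 'L(X, Y)) (D : 'L(U, Y)).
Implicit Types (l z : Cpow R d).
Hypothesis cU : contractive_realization A B C D.
Let V := (connecting_op A B C D)^#.

(** A is a corner of the connecting operator: feed in (x, 0) and keep the first component. *)
Lemma contractive_colop : contractive (colop A).
Proof.
move=> x; have := cU ((x, 0) : hsum X U).
have -> : `|((x, 0) : hsum X U)| = `|x|.
  apply/eqP; rewrite -(eqrXn2 (n := 2)) // !norm_sqr_inner hsum_innerE /=.
  by rewrite (linear0l inner) addr0.
apply: le_trans; apply: le_trans (hsum_norm1_le _).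
by rewrite -[(connecting_op _ _ _ _ _).1]/(colop A x + colop B 0) linear0 addr0.
Qed.

Lemma adj_connecting_op h y :
  V ((h, y) : hsum (hpow d X) Y) =
  ((colop A)^# h + C^# y, (colop B)^# h + D^# y).
Proof.
apply: inner_inj => -[x u]; rewrite -inner_adj !hsum_innerE /=.
by rewrite !innerDl !innerDr -!inner_adj addrACA.
Qed.

Let G z := opinv (opid X - (colop A)^# *o (Zop X z)^#).

Lemma adj_resolvent z : unit_ball z ->
  (opinv (opid X - Zop X z *o colop A))^# = G z.
Proof.
move=> z1; rewrite -opinv_adj ?adjB ?adj_id ?adj_comp //.
exact: invertible_one_sub_Zop_colop contractive_colop z1.
Qed.

Lemma adj_transfer_function z : unit_ball z ->
  (transfer_function A B C D z)^# =
  D^# + (colop B)^# *o ((Zop X z)^# *o G z *o C^#).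
Proof.
by move=> z1; rewrite adjD !adj_comp adj_resolvent //; apply/bopP.
Qed.

(** The pair (h, y) attached to z; the vector g is [G z (C^# y)]. *)
Definition D_lift z (y : Y) : hsum (hpow d X) Y :=
  (((Zop X z)^# *o G z *o C^#) y, y).

Lemma adj_connecting_op_D_lift z y : unit_ball z ->
  V (D_lift z y) = (G z (C^# y), (transfer_function A B C D z)^# y).
Proof.
move=> z1; rewrite adj_connecting_op adj_transfer_function //=.
congr (_, _); last by rewrite addrC.
have invG : op_invertible (opid X - (colop A)^# *o (Zop X z)^#).
  have := invertible_adj (invertible_one_sub_Zop_colop contractive_colop z1).
  by rewrite adjB adj_id adj_comp.
have := opinvK (C^# y) invG; rewrite -/(G z) bopB /= => e.
(* The resolvent equation [e] replaces [C^# y] by g minus [(colop A)^#] applied to h, which leaves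
   g. *)
by rewrite -[X in _ + X = _]e addrC subrK.
Qed.

Lemma K_S_eq_K_CA_iff l z : unit_ball l -> unit_ball z ->
  K_S (transfer_function A B C D) l z = K_CA C A l z <->
  forall y y',
    inner (V (D_lift z y)) (V (D_lift l y')) = inner (D_lift z y) (D_lift l y').
Proof.
move=> l1 z1.
have KCA y y' : inner (K_CA C A l z y) y' = inner (G z (C^# y)) (G l (C^# y')).
  rewrite /K_CA -Zop_colop -adj_Zop_colop /= inner_adj.
  by rewrite -(adj_resolvent l1) -[RHS]inner_adj.
set F := transfer_function A B C D.
have KS := inner_K_S F l z.
have lz := one_sub_inner_neq0 l1 z1.
(* With a = <l, z>, the left side is preservation of the inner product and the right side is the
   kernel identity multiplied by 1 - <l, z>. *)
have rearrange (a g f b : R[i]) : g + f = a * g + b <-> b - f = (1 - a) * g.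
  split=> [e|e]; last by rewrite -[b](subrK f) e; ring.
  have -> : b = (a * g + b) - a * g by ring.
  by rewrite -e; ring.
have VV y y' : inner (V (D_lift z y)) (V (D_lift l y')) =
    inner (G z (C^# y)) (G l (C^# y')) + inner ((F z)^# y) ((F l)^# y').
  by rewrite !adj_connecting_op_D_lift // hsum_innerE.
have DD y y' : inner (D_lift z y) (D_lift l y') =
    inner l z * inner (G z (C^# y)) (G l (C^# y')) + inner y y'.
  by rewrite hsum_innerE /= inner_adj_Zop.
split=> [eqK y y'|eqV].
  rewrite VV DD; apply/rearrange.
  by rewrite -KCA -eqK KS mulVKf.
apply/bopP => y; apply: inner_inj => y'.
rewrite innerC [RHS]innerC KS KCA; congr (_^*).
apply: (mulfI lz); rewrite mulVKf //; apply/rearrange.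
by rewrite -VV -DD.
Qed.

(** The span whose closure is [D_space]; isometry is proved on it first and then extended by
    continuity. *)
Let D_algebraic : set (hpow d X) :=
  [set v | exists n (a : 'I_n -> R[i]) (w : 'I_n -> hpow d X),
    (forall i, exists z y, unit_ball z /\
      w i = ((Zop X z)^# *o G z *o C^#) y) /\
    v = \sum_(i < n) a i *: w i].

(** The Y-component y is independent of v because the lifts at z = 0 are the vectors (0, y); this is
    the base case of an induction on the number of terms. *)
Lemma linear_form_D_eq0 (f : hsum (hpow d X) Y -> R[i]) :
  (forall a x y, f (a *: x + y) = a * f x + f y) ->
  (forall z y, unit_ball z -> f (D_lift z y) = 0) ->
  forall v y, D_algebraic v -> f (v, y) = 0.
Proof.
move=> flin f0 _ y [n [a [w [wD ->]]]].
elim: n a w wD y => [|n IHn] a w wD y.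
  rewrite big_ord0.
  have <- : D_lift 0 y = (0, y).
    rewrite /D_lift /=; congr (_, _); rewrite adj_Zop; apply/funext => j.
    by rewrite -[(0 : Cpow R d) j]/(0 : R[i]) conjC0 scale0r.
  by apply: f0; rewrite /unit_ball /= normr0 ltr01.
have [z [y0 [z1 wE]]] := wD ord0.
rewrite big_ord_recl.
set s := \sum_(i < n) _.
have -> : (a ord0 *: w ord0 + s, y) =
    a ord0 *: D_lift z y0 + ((s, y - a ord0 *: y0) : hsum (hpow d X) Y).
  by congr (_, _); rewrite ?wE //= addrC subrK.
by rewrite flin f0 // mulr0 add0r IHn.
Qed.

Lemma isometric_on_D :
  (forall l z y y', unit_ball l -> unit_ball z ->
     inner (V (D_lift z y)) (V (D_lift l y')) = inner (D_lift z y) (D_lift l y')) ->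
  isometric_on V [set w | D_space A C w.1].
Proof.
move=> VD [h y] /= Dh.
(* The isometry defect, a Hermitian form that vanishes on pairs of lifts. *)
pose q v w := inner (V v) (V w) - inner v w.
have qP a u v w : q (a *: u + v) w = a * q u w + q v w.
  by rewrite /q linearP !innerDl !innerZl; ring.
have qC v w : q v w = (q w v)^* by rewrite /q rmorphB /= -!innerC.
have q0 v y1 : D_algebraic v -> q (v, y1) (v, y1) = 0.
  (* Extension from lifts to the span, one variable at a time; [qC] exchanges the variables. *)
  move=> Dv; apply: (linear_form_D_eq0 (f := q^~ (v, y1))) (Dv) => // z y2 z1.
  rewrite qC; apply/eqP; rewrite conjC_eq0; apply/eqP.
  apply: (linear_form_D_eq0 (f := q^~ (D_lift z y2))) (Dv) => // l y' l1.
  by rewrite /q VD // subrr.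
have cV := contractive_adj cU.
apply/eqP; rewrite eq_sym -subr_eq0; apply/eqP.
set v : hsum (hpow d X) Y := (h, y).
(* One e is lost in passing from v to v' and another in passing from V v' back to V v. *)
apply: (@eq0_of_le_eps _ _ 2) => [|e e0]; first by rewrite subr_ge0 cV.
have [h' [Dh' hh']] := Dh _ (nbhsx_ballx h e e0).
pose v' : hsum (hpow d X) Y := (h', y).
have vv' : `|v - v'| < e.
  apply: le_lt_trans (hsum_norm_le _) _; rewrite /= subrr normr0 addr0.
  by move: hh'; rewrite -ball_normE.
have nv' : `|V v'| = `|v'|.
  apply/eqP; rewrite -(eqrXn2 (n := 2)) // !norm_sqr_inner -subr_eq0; apply/eqP.
  exact: q0.
rewrite lerBlDr -(subrK v' v) (le_trans (ler_normD _ _)) // mulr_natl mulr2n.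
rewrite -addrA lerD ?(ltW vv') // -nv' subrK.
rewrite -{1}(subrK v v') linearD (le_trans (ler_normD _ _)) // lerD //.
by rewrite (le_trans (cV _)) // distrC ltW.
Qed.

End Colligation.

(** * Polarization and the equivalence *)

(** The norm defect at a v + w is a polynomial in a and its conjugate whose linear coefficient t is
    the inner product defect; the value at 0 removes r, and opposite values of a cancel the even
    term in s. *)
Lemma polarization (R : realType) (H K : hilbertType R) (T : 'L(H, K)) v w :
  (forall a, `|T (a *: v + w)| = `|a *: v + w|) ->
  inner (T v) (T w) = inner v w.
Proof.
move=> Tn.
have Tn2 a : inner (T (a *: v + w)) (T (a *: v + w)) =
    inner (a *: v + w) (a *: v + w) by rewrite -!norm_sqr_inner Tn.
apply/subr0_eq; set t := _ - _.
pose s := inner (T v) (T v) - inner v v.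
pose r := inner (T w) (T w) - inner w w.
have E a : a * t + a^* * t^* + a * a^* * s + r = 0.
  have := Tn2 a => /eqP; rewrite -subr_eq0 => /eqP <-.
  rewrite linearP !innerDl !innerDr !innerZl !innerZr.
  rewrite /t rmorphB /= -!innerC /s /r; ring.
have r0 : r = 0 by have := E 0; rewrite rmorph0 !mul0r !add0r.
(* The cases a = t^* and a = - t^* differ by 4 |t|^2 = 0. *)
have e1 := E (t^*); have e2 := E (- t^*).
rewrite !rmorphN /= !conjCK r0 in e1 e2.
apply/eqP; rewrite -normr_eq0 -sqrf_eq0 normCK; apply/eqP.
apply: (@mulfI _ 4%:R); first by rewrite pnatr_eq0.
have -> : 4%:R * (t * t^*) = (t^* * t + t * t^* + t^* * t * s + 0) -
   (- t^* * t + - t * t^* + - t^* * - t * s + 0) by ring.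
by rewrite e1 e2 subrr mulr0.
Qed.

Theorem proposition1p5 (R : realType) (d : nat) (U Y X : hilbertType R)
    (S : Cpow R d -> 'L(U, Y))
    (A : 'I_d -> 'L(X, X)) (B : 'I_d -> 'L(U, X))
    (C : 'L(X, Y)) (D : 'L(U, Y)) :
  schur_class S ->
  realizes A B C D S ->
  contractive_realization A B C D ->
  (weakly_coisometric A B C D <->
   forall l z : Cpow R d, unit_ball l -> unit_ball z ->
     K_S S l z = K_CA C A l z).
Proof.
move=> _ SE cU; have cV := contractive_adj cU.
have KE l z : unit_ball l -> unit_ball z ->
    K_S S l z = K_S (transfer_function A B C D) l z.
  by move=> l1 z1; rewrite /K_S !SE.
split=> [[_ isoV] l z l1 z1|eqK].
  rewrite KE //; apply: (K_S_eq_K_CA_iff cU l1 z1).2 => y y'.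
  apply: polarization => a; apply: isoV; apply: subset_closure.
  (* The first component of a v + w is the combination of two generators of D with coefficients a
     and 1. *)
  exists 2, (fun i => if i == ord0 then a else 1).
  exists (fun i => if i == ord0 then (D_lift A C z y).1 else (D_lift A C l y').1).
  split=> [i|]; last by rewrite big_ord_recl big_ord1 /= scale1r.
  by case: ifP => _; [exists z, y | exists l, y'].
split=> //; apply: (isometric_on_D cU) => l z y y' l1 z1.
by apply: (K_S_eq_K_CA_iff cU l1 z1).1; rewrite -KE ?eqK.
Qed.
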